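(* Let $k\ge 2$ and let $M_1,\dots,M_k$ be real symmetric matrices of orders $n_1,\dots,n_k$ such that $\operatorname{trace}(M_i)=0$ and $M_i\mathbf{1}_{n_i}=r_i\mathbf{1}_{n_i}$ with $r_i\ge 0$, for each $1\le i\le k$. Let $a\neq 0$ be a real constant and let $M=M[M_1,\dots,M_k,a]$ be the symmetric block matrix of order $n=n_1+\dots+n_k$ whose $i$-th diagonal block is $M_i$ and whose $(i,j)$ off-diagonal block ($i\ne j$) is $aJ_{n_i\times n_j}$. Let $\rho_{\max}=\max_{1\le i\le k} r_i/n_i$ and $\rho_{\min}=\min_{1\le i\le k} r_i/n_i$. Then: (i) if $a>0$ and $-a+\rho_{\min}\ge 0$, then $\mathcal{E}(M)=\sum_{i=1}^k\mathcal{E}(M_i)$; (ii) if, for each $1\le i\le k$, $M_i$ has at most one positive eigenvalue, namely $r_i$, and $-a+\rho_{\max}\le 0$, then $\mathcal{E}(M)=2\lambda_1(M)$; (iii) if $a<0$ and $a(k-1)+\rho_{\min}\le \lambda_{\min}(M_i)\le 0$ for all $1\le i\le k$, where $\lambda_{\min}(M_i)$ is the smallest eigenvalue of $M_i$, then $\mathcal{E}(M)=\sum_{i=1}^k\mathcal{E}(M_i)-2\lambda_n(M)$.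
   Context: $\mathbf{1}_m$ is the all-ones column vector of length $m$, $J_{p\times q}$ is the $p\times q$ all-ones matrix. For a Hermitian matrix $H$ of order $n$, its eigenvalues are $\lambda_1(H)\ge\lambda_2(H)\ge\dots\ge\lambda_n(H)$. The energy $\mathcal{E}(X)$ of a complex matrix $X$ is the sum of its singular values (for a real symmetric matrix, the sum of absolute values of its eigenvalues). In (iii), the paper writes $\lambda_{n_i}$ for the smallest eigenvalue of $M_i$. *)

(* Defs.v *)
From HB Require Import structures.
From mathcomp Require Import all_boot all_order all_algebra.
From mathcomp Require Import complex reals.

Set Implicit Arguments.
Unset Strict Implicit.
Unset Printing Implicit Defensive.

Import Order.TTheory GRing.Theory Num.Theory.
Local Open Scope ring_scope.

(* Listed with algebraic multiplicity, in no particular order. *)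
Definition spectrum (R : rcfType) n (A : 'M[R[i]]_n) : seq R[i] :=
  sval (closed_field_poly_normal (char_poly A)).

Lemma spectrumP (R : rcfType) n (A : 'M[R[i]]_n) :
  char_poly A = \prod_(z <- spectrum A) ('X - z%:P).
Proof.
rewrite /spectrum; case: closed_field_poly_normal => s /= {1}->.
by rewrite (eqP (char_poly_monic A)) scale1r.
Qed.

(* Meaningful for Hermitian H, whose spectrum is real, so that taking real
   parts loses nothing. *)
Definition eigenvalues (R : rcfType) n (H : 'M[R[i]]_n) : seq R :=
  sort >=%R [seq complex.Re z | z <- spectrum H].

(* The index is 1-based: lambda 1 H is the largest eigenvalue of H, and
   lambda n H the smallest one. *)
Definition lambda (R : rcfType) n (j : nat) (H : 'M[R[i]]_n) : R :=
  (eigenvalues H)`_j.-1.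

(* The list has size q; if p < q, its last q - p entries are extra zeros. *)
Definition singular_values (R : rcfType) p q (X : 'M[R[i]]_(p, q)) : seq R :=
  [seq Num.sqrt x | x <- eigenvalues (map_mx Num.conj X^T *m X)].

Definition energy (R : rcfType) p q (X : 'M[R[i]]_(p, q)) : R :=
  \sum_(s <- singular_values X) s.

Definition cplx (R : rcfType) p q (A : 'M[R]_(p, q)) : 'M[R[i]]_(p, q) :=
  map_mx (real_complex R) A.

(* For i = j the dimensions agree and conform_mx 0 (M_ i) is M_ i; it is
   needed because j is not convertible to i. *)
Definition block_join (R : nmodType) k (n : 'I_k -> nat)
    (M_ : forall i, 'M[R]_(n i)) (a : R) : 'M[R]_(\sum_i n i) :=
  \mxblock_(i, j) (if i == j then conform_mx 0 (M_ i) else const_mx a).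

Lemma block_join_diag (R : nmodType) k (n : 'I_k -> nat)
    (M_ : forall i, 'M[R]_(n i)) (a : R) i :
  submxblock (block_join M_ a) i i = M_ i.
Proof. by rewrite mxblockK eqxx conform_mx_id. Qed.

Lemma block_join_offdiag (R : nmodType) k (n : 'I_k -> nat)
    (M_ : forall i, 'M[R]_(n i)) (a : R) i j :
  i != j -> submxblock (block_join M_ a) i j = const_mx a.
Proof. by rewrite mxblockK => /negPf->. Qed.

(* The value 0 is used only when k = 0. *)
Definition fmax (R : realDomainType) k (f : 'I_k -> R) : R :=
  \big[Num.max/head 0 (codom f)]_(i < k) f i.

Definition fmin (R : realDomainType) k (f : 'I_k -> R) : R :=
  \big[Num.min/head 0 (codom f)]_(i < k) f i.

(* Main.v *)
Require Import Defs.
From HB Require Import structures.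
From mathcomp Require Import all_boot all_order all_algebra.
From mathcomp Require Import complex reals.
From mathcomp Require Import ring lra.

Set Implicit Arguments.
Unset Strict Implicit.
Unset Printing Implicit Defensive.

Import Order.TTheory GRing.Theory Num.Theory.
Local Open Scope ring_scope.

(* Subtracting from the block-diagonal matrix of the M_i its part on the span of
   the normalized block indicators shows that the spectrum of M together with
   r_1, ..., r_k is the union of the spectra of the M_i and of the k x k matrix
   Q = diag (r_i - a n_i) + a w w^T, where w_i = sqrt n_i. Hence
   E(M) + sum r_i = sum E(M_i) + E(Q), and tr Q = sum r_i. In (i) Q is positive
   semidefinite. In (ii) and (iii) Q is a rank-one update of a semidefinite
   diagonal matrix, so it has at most one positive, respectively negative,
   eigenvalue. In (iii) a Rayleigh quotient shows that this eigenvalue is at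
   most a (k - 1), hence below every eigenvalue of the M_i. *)

(** * Determinants and characteristic polynomials of block matrices and products *)

Lemma det_castmx_square (R : comNzRingType) m n (e e' : m = n) (A : 'M[R]_m) :
  \det (castmx (e, e') A) = \det A.
Proof. by case: n / e in e' *; rewrite castmx_id. Qed.

Lemma det_mxdiag (R : comNzRingType) k (n : 'I_k -> nat)
    (B_ : forall i, 'M[R]_(n i)) :
  \det (\mxdiag_i B_ i) = \prod_i \det (B_ i).
Proof.
elim: k => [|k IHk] in n B_ *.
  (* The order of this matrix is an empty sum, which becomes 0 only by rewriting; generalizing the
     matrix first makes that rewrite possible. *)
  by rewrite [RHS]big_ord0; move: (\mxdiag_i _); rewrite big_ord0 => A;
    exact: det_mx00.
by rewrite mxdiag_recl det_castmx_square det_ublock IHk big_ord_recl.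
Qed.

Lemma char_poly_mxdiag (R : comNzRingType) k (n : 'I_k -> nat)
    (B_ : forall i, 'M[R]_(n i)) :
  char_poly (\mxdiag_i B_ i) = \prod_i char_poly (B_ i).
Proof.
rewrite -det_mxdiag /char_poly; congr (\det _).
rewrite /char_poly_mx mxdiagB mxdiagZ; congr (_ - _).
apply/matrixP => s t; rewrite !mxE.
move: (tagnat.sig2 s) (tagnat.sig2 t).
case: eqVneq => [<-|_] x y; last by rewrite !mxE.
by rewrite !conform_mx_id !mxE.
Qed.

(** Clearing the lower left block of [H] by a right factor produces [x%:M - A *m B], by a left
    factor [x%:M - B *m A]. The powers of [x] absorb the difference in size, so [x] need not be
    invertible. *)
Lemma det_sylvester (R : comNzRingType) m n (x : R) (A : 'M[R]_(m, n)) B :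
  x ^+ n * \det (x%:M - A *m B) = x ^+ m * \det (x%:M - B *m A).
Proof.
pose H := block_mx x%:M A B 1%:M.
have <- : \det H = \det (x%:M - A *m B).
  have := det_mulmx H (block_mx 1%:M 0 (- B) 1%:M).
  rewrite mulmx_block !mulmx1 !mulmx0 mulmxN mul1mx subrr add0r add0r.
  by rewrite det_ublock det_lblock !det1 !mulr1 => ->.
have := det_mulmx (block_mx 1%:M 0 (- B) x%:M) H.
rewrite mulmx_block !mul1mx !mul0mx !addr0 mulNmx mul_mx_scalar mul_scalar_mx.
rewrite addNr mulmx1 det_ublock det_lblock det1 mul1r !det_scalar => <-.
by rewrite mulNmx addrC.
Qed.

Lemma char_poly_mulC (R : comNzRingType) m n (A : 'M[R]_(m, n)) B :
  'X^n * char_poly (A *m B) = 'X^m * char_poly (B *m A).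
Proof. by rewrite /char_poly /char_poly_mx !map_mxM det_sylvester. Qed.

(** In (X - N)(X - S) the product N S drops out, leaving X (X - N - S); take determinants. *)
Lemma char_polyD_mul0 (R : comNzRingType) n (N S : 'M[R]_n) :
  N *m S = 0 -> 'X^n * char_poly (N + S) = char_poly N * char_poly S.
Proof.
move=> NS0; rewrite /char_poly -det_scalar -!det_mulmx; congr (\det _).
rewrite /char_poly_mx map_mxD.
have := map_mxM (@polyC R) N S; rewrite NS0 map_mx0 => NS.
rewrite !(mulmxBl, mulmxBr, mulmxDr) -NS subr0 (scalar_mxC _ (map_mx _ N)).
by rewrite opprD addrA addrAC.
Qed.

(* With N = G - P D L we have N P = 0, so both characteristic polynomials
   factor through that of N. *)
Lemma char_poly_deflation (R : idomainType) n k (G : 'M[R]_n)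
    (P : 'M[R]_(n, k)) (L : 'M[R]_(k, n)) (D Q : 'M[R]_k) :
  L *m P = 1%:M -> G *m P = P *m D ->
  char_poly (G + P *m (Q - D) *m L) * char_poly D = char_poly G * char_poly Q.
Proof.
move=> LP GP; pose N := G - P *m D *m L.
have NP0 : N *m P = 0 by rewrite mulmxBl -!mulmxA LP mulmx1 GP subrr.
(* [N] annihilates [P *m S *m L], so the polynomial of the sum splits; swapping factors and using
   [L *m P = 1%:M] replaces that of [P *m S *m L] by that of [S], up to powers of ['X]. *)
have split_char S :
    'X^k * char_poly (N + P *m S *m L) = char_poly N * char_poly S.
  apply: (@mulfI _ 'X^n); first by rewrite expf_neq0 ?polyX_eq0.
  rewrite mulrCA char_polyD_mul0 ?mulmxA ?NP0 ?mul0mx// mulrCA char_poly_mulC.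
  by rewrite mulmxA LP mul1mx mulrCA.
have -> : G + P *m (Q - D) *m L = N + P *m Q *m L.
  by rewrite mulmxBr mulmxBl addrCA addrC.
apply: (@mulfI _ 'X^k); first by rewrite expf_neq0 ?polyX_eq0.
rewrite mulrA split_char mulrAC -split_char mulrA; congr (_ * char_poly _ * _).
by rewrite subrK.
Qed.

Local Open Scope sesquilinear_scope.

(** * Unitary diagonalization and Hermitian forms *)

Section UnitaryDiagonal.
Context {C : numClosedFieldType}.

Lemma unitary_conj_mul n (U A B : 'M[C]_n) : U \is unitarymx ->
  (U^t* *m A *m U) *m (U^t* *m B *m U) = U^t* *m (A *m B) *m U.
Proof. by move=> uU; rewrite !mulmxA mulmxtVK. Qed.

Lemma char_poly_unitary_diag n (U : 'M[C]_n) (D : 'rV[C]_n) :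
  U \is unitarymx ->
  char_poly (U^t* *m diag_mx D *m U) = \prod_i ('X - (D 0 i)%:P).
Proof.
move=> uU; apply: (@mulfI _ 'X^n); first by rewrite expf_neq0 ?polyX_eq0.
rewrite -mulmxA char_poly_mulC -mulmxA (unitarymxP uU) mulmx1; congr (_ * _).
rewrite char_poly_trig ?diag_mx_is_trig//.
by apply: eq_bigr => i _; rewrite !mxE eqxx.
Qed.

Lemma diag_form n (v D : 'rV[C]_n) :
  (v *m diag_mx D *m v^t*) 0 0 = \sum_i D 0 i * `|v 0 i| ^+ 2.
Proof.
rewrite mxE; apply: eq_bigr => i _.
by rewrite mul_mx_diag !mxE normCK (mulrC (v 0 i)) mulrA.
Qed.

(** The entries of [c] are coordinates in the orthonormal basis of rows of [U], in which the form is
    diagonal. *)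
Lemma unitary_diag_form n (U : 'M[C]_n) (c D : 'rV[C]_n) : U \is unitarymx ->
  ((c *m U) *m (U^t* *m diag_mx D *m U) *m (c *m U)^t*) 0 0
    = \sum_i D 0 i * `|c 0 i| ^+ 2.
Proof.
move=> uU; rewrite -diag_form trmx_mul map_mxM !mulmxA mulmxtVK//.
by rewrite mulmxtVK.
Qed.

End UnitaryDiagonal.

(** * Eigenvalues and energy of real symmetric matrices *)

Section SymmetricSpectrum.
Context {R : rcfType}.
Local Notation C := R[i].

Lemma eigenvalues_unitary_diag n (U : 'M[C]_n) (d : 'rV[R]_n) :
  U \is unitarymx ->
  perm_eq (eigenvalues (U^t* *m diag_mx (cplx d) *m U)) (codom (d 0)).
Proof.
move=> uU; rewrite /eigenvalues perm_sort.
have -> : codom (d 0) = map (@complex.Re R) (codom (cplx d 0)).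
  by rewrite /codom /image_mem -map_comp; apply: eq_map => i /=; rewrite mxE.
apply/perm_map/prod_XsubC_eq; rewrite -spectrumP.
by apply: etrans (char_poly_unitary_diag _ uU) _; rewrite big_map enumT.
Qed.

Lemma conj_cplx (x : R) : Num.conj (x%:C)%C = (x%:C)%C.
Proof. by apply: conj_Creal; apply/complex_realP; exists x. Qed.

Lemma cplx_hermsym n (A : 'M[R]_n) : A^T = A -> cplx A \is hermsymmx.
Proof.
move=> sA; apply/is_hermitianmxP; rewrite expr0 scale1r.
by apply/matrixP => i j; rewrite !mxE conj_cplx -{1}sA mxE.
Qed.

(** The Hermitian spectral theorem over [R[i]]: the eigenvalues are real and come from a row [d]
    over [R], while [U] may be complex. *)
Lemma symmetric_spectral n (A : 'M[R]_n) : A^T = A ->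
  exists (U : 'M[C]_n) (d : 'rV[R]_n),
    [/\ U \is unitarymx, (cplx A) = U^t* *m diag_mx (cplx d) *m U
      & perm_eq (eigenvalues (cplx A)) (codom (d 0))].
Proof.
move=> /cplx_hermsym hA.
have uU := spectral_unitarymx (cplx A).
have /hermitian_normalmx/orthomx_spectralP eA := hA.
have rD := hermitian_spectral_diag_real hA.
pose d := map_mx (@complex.Re R) (spectral_diag (cplx A)).
have dE : spectral_diag (cplx A) = cplx d.
  by apply/matrixP => i j; rewrite !mxE; apply/esym/RRe_real/(mxOverP rD).
rewrite invmx_unitary// dE in eA.
exists (spectralmx (cplx A)), d; split=> //.
by rewrite [X in eigenvalues X]eA eigenvalues_unitary_diag.
Qed.

(** The Gram matrix behind the singular values is the square of [cplx A]; the same [U] diagonalizes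
    it with entries [d 0 i ^+ 2], whose square roots are absolute values. *)
Lemma energy_symmetric n (A : 'M[R]_n) : A^T = A ->
  energy (cplx A) = \sum_(x <- eigenvalues (cplx A)) `|x|.
Proof.
move=> sA; have [U [d [uU eA pA]]] := symmetric_spectral sA.
rewrite /energy /singular_values big_map [RHS](perm_big _ pA) /= [RHS]big_map.
have -> : map_mx Num.conj (cplx A)^T *m cplx A =
    U^t* *m diag_mx (cplx (\row_i (d 0 i ^+ 2))) *m U.
  have /is_hermitianmxP := cplx_hermsym sA; rewrite expr0 scale1r => <-.
  rewrite eA; apply: etrans (unitary_conj_mul _ _ uU) _; rewrite mulmx_diag.
  set D1 := \row_j _; suff -> : D1 = cplx (\row_i (d 0 i ^+ 2)) by [].
  by apply/rowP => i; rewrite !mxE expr2 rmorphM.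
rewrite (perm_big _ (eigenvalues_unitary_diag _ uU)) /= big_map.
by apply: eq_bigr => i _; rewrite mxE sqrtr_sqr.
Qed.

Lemma char_poly_eigenvalues n (A : 'M[R]_n) : A^T = A ->
  char_poly A = \prod_(x <- eigenvalues (cplx A)) ('X - x%:P).
Proof.
move=> sA; have [U [d [uU eA pA]]] := symmetric_spectral sA.
apply: (@map_poly_inj _ _ (real_complex R)).
rewrite map_char_poly -/(cplx A) (perm_big _ pA) map_prod_XsubC/=.
rewrite eA; apply: etrans (char_poly_unitary_diag _ uU) _.
by rewrite big_map enumT; apply: eq_bigr => i _; rewrite mxE.
Qed.

Lemma size_eigenvalues n (A : 'M[R]_n) : A^T = A ->
  size (eigenvalues (cplx A)) = n.
Proof.
move=> sA; have [U [d [_ _ /perm_size->]]] := symmetric_spectral sA.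
by rewrite size_codom card_ord.
Qed.

Lemma sum_eigenvalues n (A : 'M[R]_n) : A^T = A ->
  \sum_(x <- eigenvalues (cplx A)) x = \tr A.
Proof.
move=> sA; have [U [d [uU eA pA]]] := symmetric_spectral sA.
rewrite (perm_big _ pA) big_map enumT; apply: (@complexI R).
transitivity (\tr (cplx A)); last first.
  by rewrite /mxtrace rmorph_sum; apply: eq_bigr => i _; rewrite mxE.
rewrite eA -mulmxA mxtrace_mulC -mulmxA (unitarymxP uU) mulmx1 mxtrace_diag.
by rewrite rmorph_sum; apply: eq_bigr => i _; rewrite mxE.
Qed.

Lemma sorted_eigenvalues n (A : 'M[C]_n) : sorted >=%R (eigenvalues A).
Proof. by apply: sort_sorted => x y; exact: le_total. Qed.

Lemma lambda_le n (A : 'M[R]_n) x : A^T = A ->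
  x \in eigenvalues (cplx A) -> lambda n (cplx A) <= x.
Proof.
move=> sA /(nthP 0) [j]; rewrite /lambda (size_eigenvalues sA) => lt_in <-.
apply: (sorted_leq_nth ge_trans ge_refl 0 (sorted_eigenvalues _)).
- by rewrite inE size_eigenvalues.
(* [lambda n] reads position [n.-1], which is valid because the membership of [x] makes [n]
   positive. *)
- by rewrite inE size_eigenvalues// prednK// (leq_trans _ lt_in).
- by rewrite -ltnS prednK// (leq_trans _ lt_in).
Qed.

Lemma lambda_mem n j (A : 'M[R]_n) : A^T = A -> (0 < j <= n)%N ->
  lambda j (cplx A) \in eigenvalues (cplx A).
Proof.
by move=> sA /andP[j0 jn]; rewrite mem_nth// size_eigenvalues// prednK.
Qed.

(** By contraposition: if every eigenvalue exceeds [t], the sum of the (d_i - t) |c_i|^2 has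
    nonnegative terms but is at most 0, so all coordinates c_i vanish and [v] is zero. *)
Lemma Rayleigh_min n (A : 'M[R]_n) (v : 'rV[R]_n) t : A^T = A -> v != 0 ->
  (v *m A *m v^T) 0 0 <= t * \sum_i v 0 i ^+ 2 ->
  exists2 x, x \in eigenvalues (cplx A) & x <= t.
Proof.
move=> sA v0 vAv; have [U [d [uU eA pA]]] := symmetric_spectral sA.
apply/hasP; apply: contraNT v0 => /hasPn gt_t.
pose c := (cplx v) *m U^t*.
have uU' : U^t* \is unitarymx by rewrite trmxC_unitary.
have cU : c *m U = cplx v by rewrite -[U in _ *m U]trmxCK mulmxtVK.
have vC : (cplx v)^t* = cplx v^T.
  by apply/matrixP => i j; rewrite !mxE conj_cplx.
suff c0 : c = 0.
  apply/eqP/rowP => i; apply: (@complexI R).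
  by have /rowP/(_ i) := cU; rewrite c0 mul0mx !mxE => <-.
have Q1 := unitary_diag_form c (cplx d) uU.
rewrite cU -eA vC in Q1.
(* Parseval: passing to the coordinates [c] preserves the norm of [v]. *)
have Q2 : \sum_i `|c 0 i| ^+ 2 = (\sum_i v 0 i ^+ 2)%:C%C.
  transitivity ((c *m c^t*) 0 0).
    by rewrite mxE; apply: eq_bigr => i _; rewrite !mxE normCK.
  rewrite trmx_mul map_mxM trmxCK mulmxA cU vC -map_mxM !mxE; congr (_%:C%C).
  by apply: eq_bigr => i _; rewrite mxE expr2.
rewrite -!map_mxM mxE in Q1.
have : \sum_i ((d 0 i - t)%:C%C * `|c 0 i| ^+ 2) <= 0.
  under eq_bigr do rewrite rmorphB mulrBl.
  rewrite sumrB subr_le0 -mulr_sumr Q2 -rmorphM.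
  have -> : \sum_i (d 0 i)%:C%C * `|c 0 i| ^+ 2
      = ((v *m A *m v^T) 0 0)%:C%C.
    apply: etrans (esym Q1); apply: eq_bigr => i _.
    by congr (_ * _); rewrite mxE.
  by rewrite lecR.
have dgt i : t < d 0 i.
  by rewrite ltNge gt_t// (perm_mem pA) codom_f.
move=> le0; apply/rowP => i; rewrite [RHS]mxE; apply/eqP; rewrite -normr_eq0.
rewrite -sqrf_eq0.
have term_ge0 j : true -> 0 <= (d 0 j - t)%:C%C * `|c 0 j| ^+ 2.
  by move=> _; rewrite mulr_ge0 ?exprn_ge0// ler0c subr_ge0 ltW.
have /eqP : \sum_i ((d 0 i - t)%:C%C * `|c 0 i| ^+ 2) = 0.
  by apply/eqP; rewrite eq_le le0 sumr_ge0.
rewrite psumr_eq0// => /allP/(_ i); rewrite mem_index_enum => /(_ isT).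
rewrite mulf_eq0 => /orP[|//]; rewrite (inj_eq (@complexI R) _ 0).
by rewrite subr_eq0 gt_eqF.
Qed.

(** * Rank-one updates of real diagonal matrices *)

Section RankOneUpdate.
Variables (n : nat) (D w : 'rV[R]_n) (a : R).
Local Notation Q := (diag_mx D + a *: (w^T *m w)).

Lemma rank_one_update_sym : Q^T = Q.
Proof. by rewrite linearD linearZ /= tr_diag_mx trmx_mul trmxK. Qed.

Lemma rank_one_update_form (v : 'rV[C]_n) :
  (v *m (cplx Q) *m v^t*) 0 0 =
  \sum_j (D 0 j)%:C%C * `|v 0 j| ^+ 2
    + a%:C%C * `|(v *m ((cplx w))^T) 0 0| ^+ 2.
Proof.
have -> : cplx Q = diag_mx (cplx D) + a%:C%C *: (((cplx w))^T *m (cplx w)).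
  by rewrite /cplx map_mxD map_diag_mx map_mxZ map_mxM map_trmx.
rewrite mulmxDr mulmxDl mxE diag_form; congr (_ + _).
  by apply: eq_bigr => i _; rewrite mxE.
rewrite -scalemxAr -scalemxAl mxE; congr (_ * _).
rewrite (mulmxA v) -(mulmxA (v *m _)) mxE big_ord1 normCK; congr (_ * _).
rewrite !mxE rmorph_sum; apply: eq_bigr => i _.
by rewrite !mxE rmorphM /= conj_cplx mulrC.
Qed.

(** Each eigenvalue is the value of the form at a unit eigenvector, a row of [U], and both parts of
    the form are nonnegative there. *)
Lemma eigenvalues_rank_one_update_ge0 x :
  (forall j, 0 <= D 0 j) -> 0 <= a -> x \in eigenvalues (cplx Q) -> 0 <= x.
Proof.
move=> D0 a0; have [U [d [uU eQ pQ]]] := symmetric_spectral rank_one_update_sym.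
rewrite (perm_mem pQ) => /codomP[i ->].
have := unitary_diag_form (delta_mx 0 i) (cplx d) uU.
rewrite -eQ rank_one_update_form [RHS](bigD1 i)//= [in RHS]big1; last first.
  move=> j /negPf nij.
  by rewrite !mxE nij andbF normr0 expr0n mulr0.
rewrite [in RHS]mxE [delta_mx _ _ _ _]mxE !eqxx normr1 expr1n mulr1 addr0.
rewrite -ler0c => <-.
rewrite addr_ge0// ?sumr_ge0// => [j _|]; by rewrite mulr_ge0 ?ler0c ?exprn_ge0.
Qed.

(* Two eigenvectors for eigenvalues of sign s span a vector orthogonal to w, on
   which the form reduces to that of diag_mx D. *)
Lemma count_eigenvalues_rank_one_update s :
  (forall j, s * D 0 j <= 0) ->
  (count (fun x => (0 < s * x)%R) (eigenvalues (cplx Q)) <= 1)%N.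
Proof.
move=> sD; have [U [d [uU eQ pQ]]] := symmetric_spectral rank_one_update_sym.
rewrite (permP pQ) count_map leqNgt; apply/negP => cnt.
have /card_gt1P[p [q [sp sq npq]]] : (1 < #|[pred i | (0 < s * d 0 i)%R]|)%N.
  rewrite cardE size_filter -enumT; apply: leq_trans cnt _.
  by apply/eq_leq/eq_count => i; rewrite !inE.
rewrite !inE in sp sq.
(* The entries of [y] pair [w] with the eigenvectors, so [c *m y] vanishes exactly when [c *m U] is
   orthogonal to [w]. For such a [c], the form times [s] is both at most 0 and positive. *)
pose y := U *m ((cplx w))^T.
suff [c [cy c0 cpq]] : exists c : 'rV[C]_n, [/\ (c *m y) 0 0 = 0,
    c 0 p != 0 \/ c 0 q != 0 & forall j, j != p -> j != q -> c 0 j = 0].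
  have := unitary_diag_form c (cplx d) uU.
  rewrite -eQ rank_one_update_form -mulmxA cy normr0 expr0n mulr0 addr0.
  move/(congr1 (fun z => s%:C%C * z)); rewrite !mulr_sumr => E.
  have : \sum_j s%:C%C * ((D 0 j)%:C%C * `|(c *m U) 0 j| ^+ 2) <= 0.
    apply: sumr_le0 => j _.
    by rewrite mulrA -rmorphM mulr_le0_ge0 ?exprn_ge0// lecR.
  rewrite E; apply/negP/negbT/lt_geF.
  have tge j : true -> 0 <= s%:C%C * (cplx d 0 j * `|c 0 j| ^+ 2).
    move=> _; have [->|njp] := eqVneq j p.
      by rewrite mulrA mxE -rmorphM mulr_ge0 ?exprn_ge0// ler0c ltW.
    have [->|njq] := eqVneq j q.
      by rewrite mulrA mxE -rmorphM mulr_ge0 ?exprn_ge0// ler0c ltW.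
    by rewrite cpq// normr0 expr0n !mulr0.
  suff [l tl] : exists l, 0 < s%:C%C * (cplx d 0 l * `|c 0 l| ^+ 2).
    rewrite (bigD1 l)//= (lt_le_trans tl)// lerDl sumr_ge0// => j _.
    exact: tge.
  case: c0 => cn0; [exists p|exists q];
    by rewrite mulrA mxE -rmorphM mulr_gt0 ?exprn_gt0 ?normr_gt0// ltcR.
(* If [y p 0] vanishes, the eigenvector of index [p] is itself orthogonal to [w]. Otherwise the
   combination below is, and its coordinate at [q] is [- y p 0]. *)
clearbody y; have [yp0|yp0] := eqVneq (y p 0) 0.
  exists (delta_mx 0 p); split.
  - by rewrite -rowE mxE.
  - by left; rewrite mxE !eqxx oner_eq0.
  - by move=> j /negPf njp _; rewrite mxE njp andbF.
exists (y q 0 *: delta_mx 0 p - y p 0 *: delta_mx 0 q); split.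
- by rewrite mulmxBl -!scalemxAl -!rowE !mxE mulrC subrr.
- right; rewrite !mxE !eqxx [q == p]eq_sym (negPf npq).
  by rewrite mulr0 sub0r mulr1 oppr_eq0.
- by move=> j /negPf njp /negPf njq; rewrite !mxE njp njq !andbF !mulr0 subr0.
Qed.

End RankOneUpdate.

End SymmetricSpectrum.

(** * Bounds for minima and maxima of finite families *)

Lemma fmin_le (R : realDomainType) k (f : 'I_k -> R) i : fmin f <= f i.
Proof. exact: bigmin_le. Qed.

Lemma le_fmax (R : realDomainType) k (f : 'I_k -> R) i : f i <= fmax f.
Proof. exact: le_bigmax. Qed.

Lemma fmin_ge0 (R : realDomainType) k (f : 'I_k -> R) :
  (forall i, 0 <= f i) -> 0 <= fmin f.
Proof.
move=> f0; apply: le_bigmin => [|i _]; last exact: f0.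
(* The initial value of the iterated minimum is the first value of [f], or 0 if there is none. *)
case E : (codom f) => [|x s] //=.
by have /codomP[i ->] : x \in codom f by rewrite E mem_head.
Qed.

(** * The spectrum of the block matrix and its quotient matrix *)

Section BlockJoin.
Variables (R : rcfType) (k : nat) (n : 'I_k -> nat).
Variables (M_ : forall i : 'I_k, 'M[R]_(n i)) (r : 'I_k -> R) (a : R).
Hypothesis hn : forall i, (0 < n i)%N.
Hypothesis hsym : forall i, (M_ i)^T = M_ i.
Hypothesis hr : forall i,
  M_ i *m const_mx 1 = r i *: (const_mx 1 : 'cV[R]_(n i)).

(* The quotient matrix of the partition into blocks, symmetrized by conjugation
   with the diagonal matrix of the sqrt (n i). *)
Definition quotient_mx : 'M[R]_k :=
  let w := \row_i Num.sqrt (n i)%:R in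
  diag_mx (\row_i (r i - a * (n i)%:R)) + a *: (w^T *m w).

Let s i : R := Num.sqrt (n i)%:R.

Let s_neq0 i : s i != 0.
Proof. by rewrite gt_eqF// sqrtr_gt0 ltr0n. Qed.

Let sqr_s i : s i ^+ 2 = (n i)%:R.
Proof. by rewrite sqr_sqrtr ?ler0n. Qed.

Lemma quotient_mxE i j :
  quotient_mx i j = (r i - a * (n i)%:R) *+ (i == j) + a * (s i * s j).
Proof. by rewrite !mxE big_ord1 !mxE. Qed.

Lemma quotient_mx_sym : quotient_mx^T = quotient_mx.
Proof. exact: rank_one_update_sym. Qed.

Lemma block_join_sym : (block_join M_ a)^T = block_join M_ a.
Proof.
rewrite tr_mxblock; apply/eq_mxblock => i j.
have [->|nij] := eqVneq j i; first by rewrite !conform_mx_id hsym.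
by rewrite trmx_const.
Qed.

(** Deflation of the block-diagonal matrix of the [M_ i]: the columns of [P] are the normalized
    block indicators, [L] is the transpose of [P], and [hr] says that [P] intertwines with [D]. *)
Lemma char_poly_block_join :
  char_poly (block_join M_ a) * \prod_i ('X - (r i)%:P) =
  (\prod_i char_poly (M_ i)) * char_poly quotient_mx.
Proof.
pose e i : 'cV[R]_(n i) := const_mx (s i)^-1.
pose P := \mxcol_i (e i *m delta_mx 0 i).
pose L := \mxrow_i (delta_mx i 0 *m (e i)^T).
pose D := diag_mx (\row_i r i).
have ee i : (e i)^T *m e i = 1%:M.
  rewrite [LHS]mx11_scalar mxE; congr (_%:M).
  under eq_bigr do rewrite !mxE -expr2.
  rewrite sumr_const card_ord -mulr_natl exprVn sqr_s mulfV//.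
  by rewrite -sqr_s expf_neq0.
have LP : L *m P = 1%:M.
  rewrite mul_mxrow_mxcol.
  under eq_bigr do
    rewrite mulmxA -(mulmxA _ (e _)^T) ee mulmx1 mul_delta_mx.
  apply/matrixP => i j; rewrite summxE (bigD1 i)//= big1 => [|l /negPf nli].
    by rewrite !mxE eqxx addr0 eq_sym.
  by rewrite mxE eq_sym nli.
have GP : (\mxdiag_i M_ i) *m P = P *m D.
  rewrite mul_mxdiag_mxcol mxcol_mul; apply: eq_mxcol => i.
  have -> : e i = (s i)^-1 *: const_mx 1.
    by apply/colP => x; rewrite !mxE mulr1.
  rewrite mulmxA -scalemxAr hr; apply/matrixP => x j.
  rewrite mul_mx_diag !mxE !big_ord1 !mxE eqxx /=.
  by case: eqP => [->|]; rewrite ?mulr0 ?mul0r// !mulr1 mulrC.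
have <- : char_poly D = \prod_i ('X - (r i)%:P).
  rewrite char_poly_trig ?diag_mx_is_trig//.
  by apply: eq_bigr => i _; rewrite !mxE eqxx.
rewrite -char_poly_mxdiag -(char_poly_deflation _ LP GP).
congr (char_poly _ * _).
rewrite [P *m _]mxcol_mul mul_mxcol_mxrow -mxblockD; apply/eq_mxblock => i j.
rewrite -(mulmxA (e i)) -rowE -(mulmxA (e i)) (mulmxA (row _ _)) -colE.
apply/matrixP => x y; rewrite [RHS]mxE [in RHS]mxE big_ord1 [in RHS]mxE.
rewrite [in RHS]mxE big_ord1 [col _ _ _ _]mxE [row _ _ _ _]mxE [(_ - D) _ _]mxE.
(* The correction added to block (i, j) has entries (Q - D)_ij / (s_i s_j). This is 0 for i = j, as
   s_i^2 = n_i, and [a] otherwise. *)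
rewrite quotient_mxE !mxE.
case: eqVneq => [eij|nij] in y *.
  case: j / eij in y *; rewrite !conform_mx_id /= -expr2 sqr_s; ring.
rewrite !mxE /=; field; rewrite !s_neq0 //.
Qed.

(** Equal products of monic linear factors have the same roots with multiplicity. Adding [codom r]
    on the left avoids a difference of multisets. *)
Lemma eigenvalues_block_join :
  perm_eq (eigenvalues (cplx (block_join M_ a)) ++ codom r)
    (flatten [seq eigenvalues (cplx (M_ i)) | i <- enum 'I_k]
       ++ eigenvalues (cplx quotient_mx)).
Proof.
apply: prod_XsubC_eq; rewrite !big_cat /= big_flatten /= !big_map.
rewrite -(char_poly_eigenvalues block_join_sym).
rewrite -(char_poly_eigenvalues quotient_mx_sym) .
rewrite char_poly_block_join; congr (_ * _).
by apply: eq_bigr => i _; rewrite char_poly_eigenvalues.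
Qed.

Lemma tr_quotient_mx : \tr quotient_mx = \sum_i r i.
Proof.
apply: eq_bigr => i _; rewrite quotient_mxE eqxx -expr2 sqr_s mulr1n.
by rewrite subrK.
Qed.

Lemma tr_block_join : \tr (block_join M_ a) = \sum_i \tr (M_ i).
Proof.
by rewrite mxtrace_mxblock; apply: eq_bigr => i _; rewrite eqxx conform_mx_id.
Qed.

(** The all-ones vector is an eigenvector, nonzero since [n i] is positive. [eigenvalueP] concerns
    row vectors, so [hr] is transposed by symmetry. *)
Lemma row_sum_eigenvalue i : r i \in eigenvalues (cplx (M_ i)).
Proof.
rewrite -root_prod_XsubC -char_poly_eigenvalues// -eigenvalue_root_char.
apply/eigenvalueP; exists (const_mx 1).
  by apply: trmx_inj; rewrite trmx_mul hsym linearZ/= trmx_const hr.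
apply/eqP => /matrixP/(_ 0 (Ordinal (hn i))); rewrite !mxE.
exact/eqP/oner_neq0.
Qed.


(** Stated for any commutative law so as to serve both for adding absolute values and for counting
    positive eigenvalues. *)
Lemma big_eigenvalues_block_join (T : Type) (idx : T) (op : Monoid.com_law idx)
    (P : pred R) (F : R -> T) :
  op (\big[op/idx]_(x <- eigenvalues (cplx (block_join M_ a)) | P x) F x)
     (\big[op/idx]_(i | P (r i)) F (r i)) =
  op (\big[op/idx]_i \big[op/idx]_(x <- eigenvalues (cplx (M_ i)) | P x) F x)
     (\big[op/idx]_(x <- eigenvalues (cplx quotient_mx) | P x) F x).
Proof.
have := @perm_big T op idx _ _ _ P F eigenvalues_block_join.
by rewrite !big_cat big_flatten /= !big_map.
Qed.

Let M := block_join M_ a.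
Let eQ := eigenvalues (cplx quotient_mx).

Lemma energy_block_join :
  energy (cplx M) + \sum_i `|r i| =
    \sum_i energy (cplx (M_ i)) + \sum_(x <- eQ) `|x|.
Proof.
rewrite (energy_symmetric block_join_sym).
under [in RHS]eq_bigr do rewrite energy_symmetric//.
exact: (big_eigenvalues_block_join _ xpredT Num.norm).
Qed.

(** * The energy in the three cases *)

Hypothesis hr0 : forall i, 0 <= r i.
Hypothesis htr : forall i, \tr (M_ i) = 0.

Let n_gt0 i : 0 < (n i)%:R :> R.
Proof. by rewrite ltr0n. Qed.

Lemma energy_block_join_psd : 0 < a -> a <= fmin (fun i => r i / (n i)%:R) ->
  energy (cplx M) = \sum_i energy (cplx (M_ i)).
Proof.
move=> a0 a_le; apply: (addIr (\sum_i `|r i|)); rewrite energy_block_join.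
congr (_ + _); transitivity (\sum_(x <- eQ) x).
  apply: eq_big_seq => x /eigenvalues_rank_one_update_ge0 x_ge0.
  apply/ger0_norm/x_ge0 => [j|]; last exact: ltW.
  rewrite mxE subr_ge0 -ler_pdivlMr//.
  exact: le_trans a_le (fmin_le _ _).
rewrite sum_eigenvalues ?quotient_mx_sym// tr_quotient_mx.
by apply: eq_bigr => i _; rewrite ger0_norm.
Qed.

Lemma energy_block_join_one_positive : (0 < k)%N ->
  (forall i, (count (fun x : R => (0 < x)%R) (eigenvalues (cplx (M_ i))) <= 1)%N
    /\ (forall x, x \in eigenvalues (cplx (M_ i)) -> 0 < x -> x = r i)) ->
  fmax (fun i => r i / (n i)%:R) <= a ->
  energy (cplx M) = 2 * lambda 1 (cplx M).
Proof.
move=> k0 hpos a_ge.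
have cnt : (count (fun x : R => (0 < x)%R) (eigenvalues (cplx M)) <= 1)%N.
  have := big_eigenvalues_block_join addn (fun x => 0 < x) (fun=> 1%N).
  rewrite sum1_count [X in _ = (_ + X)%N]sum1_count => cntE.
  have cQ : (count (fun x : R => (0 < x)%R) eQ <= 1)%N.
    have := @count_eigenvalues_rank_one_update _ _ (\row_i (r i - a * (n i)%:R))
      (\row_i Num.sqrt (n i)%:R) a 1.
    have -> : count (fun x => 0 < 1 * x) eQ = count (fun x : R => 0 < x) eQ.
      by apply: eq_count => x; rewrite mul1r.
    apply=> j; rewrite mul1r mxE subr_le0 -ler_pdivrMr//.
    exact: le_trans (le_fmax _ j) a_ge.
  (* A positive eigenvalue of a block can only be [r i], so a block with [r i] not positive
     contributes none. *)
  have cM : (\sum_i \sum_(x <- eigenvalues (cplx (M_ i)) | (0 < x)%R) 1 <=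
             \sum_(i | (0 < r i)%R) 1)%N.
    rewrite [X in (_ <= X)%N]big_mkcond /=; apply: leq_sum => i _.
    rewrite sum1_count; have [c1 req] := hpos i; case: ifPn => // r_le0.
    rewrite leqNgt -has_count; apply/hasPn => x xe.
    by apply: contra r_le0 => x0; rewrite -(req x).
  rewrite -(leq_add2r (\sum_(i | (0 < r i)%R) 1)) cntE addnC.
  exact: leq_add.
have := size_eigenvalues block_join_sym.
have : \sum_(x <- eigenvalues (cplx M)) x = 0.
  rewrite (sum_eigenvalues block_join_sym) tr_block_join.
  by rewrite big1.
rewrite (energy_symmetric block_join_sym) /lambda.
have := sorted_eigenvalues (cplx M); move: cnt.
rewrite -/M; case: (eigenvalues _) => [|x t] /= cnt.
  (* An empty list would force order 0, but the first block has positive order. *)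
  move=> _ _ /esym/eqP; rewrite (bigD1 (Ordinal k0))//= addn_eq0.
  by rewrite eqn0Ngt hn.
move=> /(order_path_min ge_trans)/allP xt sum0 _.
rewrite !big_cons in sum0 *.
(* A positive entry after the head would make the head positive too, giving two positive
   eigenvalues. *)
have t_le0 y : y \in t -> y <= 0.
  move=> yt; rewrite leNgt; apply/negP => y0; move: cnt.
  rewrite (lt_le_trans y0 (xt _ yt)) add1n ltnS leqNgt -has_count => /hasPn.
  by move/(_ y yt); rewrite y0.
have St : \sum_(y <- t) `|y| = - \sum_(y <- t) y.
  by rewrite -sumrN; apply: eq_big_seq => y /t_le0/ler0_norm.
(* Since the trace is zero, the head balances the rest and accounts for half of the energy. *)
have xE : x = \sum_(y <- t) `|y|.
  by rewrite St; apply/eqP; rewrite -addr_eq0 sum0.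
have x0 : 0 <= x by rewrite xE sumr_ge0.
by rewrite -xE ger0_norm// mulr_natl mulr2n.
Qed.

(** Zero trace makes [r i] the opposite of the sum of the other n_i - 1 eigenvalues, each at least
    [c]. *)
Lemma row_sum_le c i : (forall x, x \in eigenvalues (cplx (M_ i)) -> c <= x) ->
  r i <= - c * ((n i)%:R - 1).
Proof.
move=> c_le; have re := row_sum_eigenvalue i.
have pe := perm_to_rem re; set t := rem _ _ in pe.
have := sum_eigenvalues (hsym i); rewrite htr (perm_big _ pe) big_cons /=.
have := perm_size pe; rewrite size_eigenvalues//= => sz.
have : \sum_(x <- t) c <= \sum_(x <- t) x.
  by rewrite big_seq [leRHS]big_seq ler_sum// => x /mem_rem/c_le.
rewrite big_const_seq count_predT iter_addr_0 -[c *+ _]mulr_natr.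
have -> : (size t)%:R = (n i)%:R - 1 :> R by rewrite sz -natr1 addrK.
by lra.
Qed.

(* Test vector: the reciprocals of the sqrt (n i). Trace zero bounds r i, so
   that the Rayleigh quotient is at most a (k - 1). *)
Lemma quotient_mx_small_eigenvalue : (0 < k)%N -> a < 0 ->
  (forall i x, x \in eigenvalues (cplx (M_ i)) -> a * (k%:R - 1) <= x) ->
  exists2 q, q \in eQ & q <= a * (k%:R - 1).
Proof.
move=> k0 a0 hlow; pose v := \row_i (s i)^-1.
apply: (@Rayleigh_min _ _ _ v); first exact: quotient_mx_sym.
  apply/eqP => /rowP/(_ (Ordinal k0)); rewrite !mxE => /eqP.
  by rewrite invr_eq0 (negPf (s_neq0 _)).
have -> : (v *m quotient_mx *m v^T) 0 0 =
    \sum_i (r i / (n i)%:R - a) + a * k%:R ^+ 2.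
  rewrite mxE; transitivity (\sum_(j < k) ((r j / (n j)%:R - a) + a * k%:R)).
    apply: eq_bigr => j _; rewrite mxE mulr_suml.
    transitivity (\sum_i ((r j / (n j)%:R - a) *+ (i == j) + a)).
      apply: eq_bigr => i _; rewrite quotient_mxE !mxE -!sqr_s.
      by case: eqVneq => [->|_] /=; field; rewrite ?s_neq0.
    rewrite big_split /= sumr_const card_ord mulr_natr (bigD1 j)//= eqxx.
    by rewrite big1 ?addr0// => i /negPf->.
  rewrite big_split /= sumr_const card_ord -[_ * _ *+ _]mulr_natr.
  by rewrite -mulrA expr2.
have -> : \sum_i v 0 i ^+ 2 = \sum_i (n i)%:R^-1.
  by apply: eq_bigr => i _; rewrite mxE exprVn sqr_s.
(* This is [row_sum_le] with c = a (k - 1), divided by n_i. Summed over the blocks, the terms - a k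
   cancel a k^2 and leave a (k - 1) times the squared norm of [v]. *)
have : \sum_i (r i / (n i)%:R - a) <=
    \sum_i (a * (k%:R - 1) * (n i)%:R^-1 - a * k%:R).
  apply: ler_sum => i _.
  have inv_ge0 : 0 <= (n i)%:R^-1 :> R by rewrite invr_ge0 ltW.
  have := ler_wpM2r inv_ge0 (row_sum_le (hlow i)).
  have E : - (a * (k%:R - 1)) * ((n i)%:R - 1) / (n i)%:R =
      a * (k%:R - 1) * (n i)%:R^-1 - a * k%:R + a.
    by field; rewrite gt_eqF.
  by rewrite E; lra.
rewrite [X in _ <= X -> _]big_split /= -mulr_sumr sumr_const card_ord.
rewrite -[(- _) *+ k]mulr_natr; lra.
Qed.

Lemma energy_block_join_one_negative : (1 < k)%N -> a < 0 ->
  (forall i x, x \in eigenvalues (cplx (M_ i)) -> a * (k%:R - 1) <= x) ->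
  energy (cplx M) =
    \sum_i energy (cplx (M_ i)) - 2 * lambda (\sum_i n i) (cplx M).
Proof.
move=> k1 a0 hlow; have k0 := ltnW k1.
have [q qQ q_le] := quotient_mx_small_eigenvalue k0 a0 hlow.
(* With [k] at least 2 the bound is strictly negative, hence so is [q]. *)
have ak : a * (k%:R - 1) < 0.
  by rewrite nmulr_rlt0// subr_gt0 ltr1n.
have q0 : q < 0 := le_lt_trans q_le ak.
have pQ := perm_to_rem qQ.
have rest_ge0 x : x \in rem q eQ -> 0 <= x.
  move=> xr; rewrite leNgt; apply/negP => x0.
  have := @count_eigenvalues_rank_one_update _ _ (\row_i (r i - a * (n i)%:R))
      (\row_i Num.sqrt (n i)%:R) a (-1).
  rewrite -/quotient_mx (permP pQ) /= mulN1r oppr_gt0 q0 add1n ltnS leqNgt.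
  rewrite -has_count => neg; suff : false by [].
  have /hasPn/(_ x xr) : ~~ has (fun y => 0 < -1 * y) (rem q eQ).
    apply: neg => j; rewrite mulN1r oppr_le0 mxE subr_ge0.
    by rewrite (le_trans _ (hr0 j))// mulr_le0_ge0 ?ltW.
  by rewrite mulN1r oppr_gt0 x0.
(* Being negative, [q] is none of the [r i], so it is an eigenvalue of [M]. Conversely, every
   eigenvalue of [M] comes from a block or from the quotient matrix, and is at least [q]. *)
have -> : lambda (\sum_i n i) (cplx M) = q.
  apply/eqP; rewrite eq_le; apply/andP; split.
    apply: lambda_le block_join_sym _.
    have := perm_mem eigenvalues_block_join q.
    rewrite !mem_cat -/eQ qQ orbT => /orP[//|/codomP[i qr]].
    by move: q0; rewrite qr ltNge hr0.
  have lM : lambda (\sum_i n i) (cplx M) \in eigenvalues (cplx M).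
    apply: lambda_mem block_join_sym _; rewrite leqnn andbT.
    by rewrite (bigD1 (Ordinal k0))//= addn_gt0 hn.
  have := perm_mem eigenvalues_block_join (lambda (\sum_i n i) (cplx M)).
  rewrite !mem_cat lM /= => /esym/orP[/flattenP[t /mapP[i _ ->]]/hlow|].
    exact: le_trans.
  rewrite -/eQ (perm_mem pQ) inE => /predU1P[->//|/rest_ge0].
  exact/le_trans/ltW.
(* Only [q] changes sign under absolute value, so the sum exceeds the trace by - 2 q. *)
have SQ : \sum_(x <- eQ) `|x| = \sum_i `|r i| - 2 * q.
  have -> : \sum_i `|r i| = \sum_(x <- eQ) x.
    rewrite sum_eigenvalues ?quotient_mx_sym// tr_quotient_mx.
    by apply: eq_bigr => i _; rewrite ger0_norm.
  rewrite !(perm_big _ pQ) !big_cons ltr0_norm//=.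
  have -> : \sum_(x <- rem q eQ) `|x| = \sum_(x <- rem q eQ) x.
    by apply: eq_big_seq => x /rest_ge0/ger0_norm.
  by lra.
have := energy_block_join; rewrite SQ; lra.
Qed.

End BlockJoin.

Theorem theorem3 (R : realType) (k : nat) (n : 'I_k -> nat)
    (M_ : forall i : 'I_k, 'M[R]_(n i)) (r : 'I_k -> R) (a : R)
    (hk : (2 <= k)%N)
    (hn : forall i : 'I_k, (0 < n i)%N)
    (hsym : forall i : 'I_k, (M_ i)^T = M_ i)
    (htr : forall i : 'I_k, \tr (M_ i) = 0)
    (hr : forall i : 'I_k,
       M_ i *m const_mx 1 = r i *: (const_mx 1 : 'cV[R]_(n i)))
    (hr0 : forall i : 'I_k, 0 <= r i)
    (ha : a != 0) :
  let M := block_join M_ a in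
  let rho_max := fmax (fun i : 'I_k => r i / (n i)%:R) in
  let rho_min := fmin (fun i : 'I_k => r i / (n i)%:R) in
  [/\ 0 < a -> 0 <= - a + rho_min ->
        energy (cplx M) = \sum_(i < k) energy (cplx (M_ i)),
      (forall i : 'I_k,
         (count (fun x : R => (0 < x)%R) (eigenvalues (cplx (M_ i))) <= 1)%N /\
         (forall x : R, x \in eigenvalues (cplx (M_ i)) -> 0 < x -> x = r i)) ->
      - a + rho_max <= 0 ->
        energy (cplx M) = 2 * lambda 1%N (cplx M)
    & a < 0 ->
      (forall i : 'I_k,
         a * (k%:R - 1) + rho_min <= lambda (n i) (cplx (M_ i)) <= 0) ->
        energy (cplx M) = \sum_(i < k) energy (cplx (M_ i))
                          - 2 * lambda (\sum_(i < k) n i)%N (cplx M)].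
Proof.
move=> M rho_max rho_min.
have k_gt0 : (0 < k)%N := ltnW hk.
split.
- move=> a_gt0 a_le; apply: energy_block_join_psd a_gt0 _ => //.
  by rewrite -subr_ge0 addrC.
- move=> hpos a_ge; apply: energy_block_join_one_positive hpos _ => //.
  by rewrite -subr_le0 addrC.
- move=> a_lt0 hlow; apply: energy_block_join_one_negative => //.
  move=> i x xe; have /andP[lam _] := hlow i.
  apply: le_trans (le_trans lam (lambda_le (hsym i) xe)).
  (* As [rho_min] is nonnegative, the assumed lower bound is at least a (k - 1). *)
  rewrite lerDl; apply: fmin_ge0 => j.
  by rewrite divr_ge0 ?ler0n.
Qed.
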